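(* Let $n$ be an arbitrary positive integer and let $\mathfrak{C}_{\mathbf{mg}}$ be the least group congruence on the semigroup $\mathscr{IPF}(\mathbb{N}^n)$. Then for $\alpha,\beta\in\mathscr{IPF}(\mathbb{N}^n)$, $\alpha\,\mathfrak{C}_{\mathbf{mg}}\,\beta$ if and only if $$\sigma_\alpha=\sigma_\beta\qquad\text{and}\qquad(\mathbf{x}_\alpha)\sigma_\alpha-\mathbf{y}_\alpha=(\mathbf{x}_\beta)\sigma_\beta-\mathbf{y}_\beta .$$
   Context: $\mathbb{N}$ is the set of positive integers; $(\mathbb{N}^n,\leqslant)$ carries the product (coordinatewise) order; ${\uparrow}\mathbf{x}=\{\mathbf{y}\in\mathbb{N}^n:\mathbf{x}\leqslant\mathbf{y}\}$ is the principal filter generated by $\mathbf{x}$. $\mathscr{IPF}(\mathbb{N}^n)$ is the semigroup (in fact an inverse semigroup) of all order isomorphisms between principal filters of $(\mathbb{N}^n,\leqslant)$, with composition of partial maps (maps written on the right, composed left to right, $z(\alpha\beta)=(z\alpha)\beta$ wherever defined). $\mathscr{S}_n$ is the group of permutations of $\{1,\ldots,n\}$ (acting on the right), and for an $n$-tuple $\mathbf{z}$ and $\sigma\in\mathscr{S}_n$, $(\mathbf{z})\sigma=(z_{(1)\sigma^{-1}},\ldots,z_{(n)\sigma^{-1}})$. For $\alpha\in\mathscr{IPF}(\mathbb{N}^n)$, $\mathbf{x}_\alpha,\mathbf{y}_\alpha\in\mathbb{N}^n$ are defined by $\operatorname{dom}\alpha={\uparrow}\mathbf{x}_\alpha$,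 $\operatorname{ran}\alpha={\uparrow}\mathbf{y}_\alpha$, and $\sigma_\alpha\in\mathscr{S}_n$ is the unique permutation with $(\mathbf{z})\alpha=(\mathbf{z}-\mathbf{x}_\alpha+\mathbf{1})\sigma_\alpha+\mathbf{y}_\alpha-\mathbf{1}$ for all $\mathbf{z}\in\operatorname{dom}\alpha$, where $\mathbf{1}=(1,\ldots,1)$. Differences of tuples are taken in $\mathbb{Z}^n$. The least group congruence on an inverse semigroup $S$ is given by: $s\,\mathfrak{C}_{\mathbf{mg}}\,t$ iff there is an idempotent $e\in S$ with $se=te$. *)

(* Defs.v *)
From HB Require Import structures.
From mathcomp Require Import all_boot all_fingroup all_algebra.
From mathcomp Require Import boolp classical_sets.

Set Implicit Arguments.
Unset Strict Implicit.
Unset Printing Implicit Defensive.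

Local Open Scope classical_set_scope.

Section Semigroups.
Variable S : semigroupType.
Local Open Scope group_scope.
Implicit Types (s t u e f : S) (C : S -> S -> Prop).

Definition idempotent e := e * e = e.

(* The usual description of the least group congruence of an inverse
   semigroup; it is justified by [Cmg_least] and, for the semigroup
   [ipf n] below, by [ipf_Cmg_least]. *)
Definition Cmg s t := exists e, idempotent e /\ s * e = t * e.

Definition congruence C :=
  [/\ forall s, C s s,
      forall s t, C s t -> C t s,
      forall s t u, C s t -> C t u -> C s u &
      forall s t u, C s t -> C (u * s) (u * t) /\ C (s * u) (t * u)].

(* The quotient S / C is a group. *)
Definition group_congruence C :=
  congruence C /\
  exists e, (forall s, C (e * s) s /\ C (s * e) s) /\
            (forall s, exists t, C (s * t) e /\ C (t * s) e).

Definition least_group_congruence C :=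
  group_congruence C /\
  forall D, group_congruence D -> forall s t, C s t -> D s t.

Definition inverse_semigroup :=
  (forall s, exists t, s * t * s = s) /\
  (forall e f, idempotent e -> idempotent f -> e * f = f * e).

Lemma Cmg_least : inhabited S -> inverse_semigroup ->
  least_group_congruence Cmg.
Proof.
move=> [s0] [reg comm].
have idl s t : s * t * s = s -> idempotent (s * t).
  by rewrite /idempotent mulgA => ->.
have idr s t : s * t * s = s -> idempotent (t * s).
  by move=> h; rewrite /idempotent -mulgA (mulgA s) h.
have idM e f : idempotent e -> idempotent f -> idempotent (e * f).
  move=> he hf; rewrite /idempotent mulgA -(mulgA e f e) (comm f e) //.
  by rewrite mulgA he -mulgA hf.
have [t0 /idl e0] := reg s0.
have cid e f : idempotent e -> idempotent f -> Cmg e f.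
  move=> he hf; exists (e * f); split; first exact: idM.
  by rewrite mulgA he (comm e f) // mulgA hf.
have sl e s : idempotent e -> Cmg (e * s) s.
  move=> he; have [t h] := reg s; have hst := comm _ _ (idl _ _ h) he.
  exists (t * e * s).
  have h1 : s * (t * e * s) = e * s.
    by rewrite !mulgA hst -!mulgA (mulgA s) h.
  split; last by rewrite -mulgA h1 mulgA he.
  by rewrite /idempotent -(mulgA (t * e) s) h1 !mulgA -(mulgA t) he.
have sr e s : idempotent e -> Cmg (s * e) s.
  by move=> he; exists e; split=> //; rewrite -mulgA he.
have trans s t u : Cmg s t -> Cmg t u -> Cmg s u.
  move=> [e [he hst]] [f [hf htu]]; exists (e * f); split; first exact: idM.
  by rewrite mulgA hst -mulgA (comm e f) // mulgA htu -mulgA.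
have sym s t : Cmg s t -> Cmg t s by move=> [e [he h]]; exists e.
have cl s t u : Cmg s t -> Cmg (u * s) (u * t).
  by move=> [e [he h]]; exists e; split=> //; rewrite -!mulgA h.
have cr s t u : Cmg s t -> Cmg (s * u) (t * u).
  move=> [e [he h]].
  apply: (trans _ (s * (e * u))); first by apply/cl/sym/sl.
  by rewrite mulgA h -mulgA; apply/cl/sl.
split.
  split; first by split=> // [s|s t u h]; [exists (s0 * t0) | split; auto].
  exists (s0 * t0); split=> s; first by split; auto.
  by have [t h] := reg s; exists t; split; apply: cid => //; auto.
move=> D [[Dr Ds Dt Dc] [e1 [De1 Dinv]]] s t [e [he h]].
have Dee : D e e1.
  have [f [Dfe _]] := Dinv e.
  have h1 : D (e * (e * f)) (e * e1) by apply: (Dc _ _ e Dfe).1.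
  rewrite mulgA he in h1.
  exact: Dt (Ds _ _ (De1 e).2) (Dt _ _ _ (Ds _ _ h1) Dfe).
have De u : D (u * e) u by exact: Dt (Dc _ _ u Dee).1 (De1 u).2.
by apply: Dt (Ds _ _ (De s)) _; rewrite h.
Qed.

End Semigroups.

Definition pnat := {m : nat | (0 < m)%N}.

Definition Nn (n : nat) := {ffun 'I_n -> pnat}.

Section PartialMaps.
Variable n : nat.
Implicit Types (x y z w : Nn n) (f g : Nn n -> option (Nn n)).

Definition leNn x y := [forall i, (val (x i) <= val (y i))%N].

Definition upset x : set (Nn n) := [set y | leNn x y].

Definition pdom f : set (Nn n) := [set z | exists w, f z = Some w].

Definition pran f : set (Nn n) := [set w | exists z, f z = Some w].

Definition order_embedding f :=
  forall z z' w w', f z = Some w -> f z' = Some w' -> leNn z z' = leNn w w'.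

Definition principal_filter_iso f :=
  exists x y, [/\ pdom f = upset x, pran f = upset y & order_embedding f].

Lemma leNn_refl x : leNn x x.
Proof. by apply/forallP. Qed.

Lemma leNn_trans y x z : leNn x y -> leNn y z -> leNn x z.
Proof.
move=> /forallP xy /forallP yz; apply/forallP => i; exact: leq_trans (yz i).
Qed.

Lemma leNn_anti x y : leNn x y -> leNn y x -> x = y.
Proof.
move=> /forallP xy /forallP yx; apply/ffunP => i; apply: val_inj.
by apply/eqP; rewrite eqn_leq xy yx.
Qed.

Definition joinNn x y : Nn n :=
  [ffun i => if (val (x i) <= val (y i))%N then y i else x i].

Lemma joinNnP x y z : leNn (joinNn x y) z = leNn x z && leNn y z.
Proof.
apply/forallP/andP => [h|[/forallP hx /forallP hy] i]; last first.
  by rewrite ffunE; case: ifP.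
split; apply/forallP => i; move: (h i); rewrite ffunE;
  case: (leqP (val (x i)) (val (y i))) => // xy; apply: leq_trans => //.
exact: ltnW.
Qed.

Lemma upsetE x y : upset x y = leNn x y.
Proof. by []. Qed.

Lemma pcomp_iso f g : principal_filter_iso f -> principal_filter_iso g ->
  principal_filter_iso (pcomp g f).
Proof.
move=> [a [b [df rf ef]]] [c [d [dg rg eg]]].
pose j := joinNn b c.
have [bj cj] : leNn b j /\ leNn c j.
  by apply/andP; rewrite -joinNnP leNn_refl.
have [u fu] : pran f j by rewrite rf.
have [v gv] : pdom g j by rewrite dg.
have fP z w : f z = Some w -> leNn u z = leNn c w.
  move=> fz; rewrite (ef _ _ _ _ fu fz) joinNnP.
  by have -> : leNn b w by rewrite -upsetE -rf; exists z.
have gP w p : g w = Some p -> leNn v p = leNn b w.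
  move=> gw; rewrite -(eg _ _ _ _ gv gw) joinNnP andbC.
  by have -> : leNn c w by rewrite -upsetE -dg; exists p.
exists u, v; split.
- apply/seteqP; split=> z /=.
    move=> [p]; rewrite /pcomp; case fz: (f z) => [w|] //= gw.
    by rewrite /upset/= (fP _ _ fz) -upsetE -dg; exists p.
  move=> uz; have [w fz] : pdom f z.
    rewrite df; apply: leNn_trans uz.
    by rewrite -upsetE -df; exists j.
  have [p gw] : pdom g w by rewrite dg upsetE -(fP _ _ fz).
  by exists p; rewrite /pcomp fz.
- apply/seteqP; split=> p /=.
    move=> [z]; rewrite /pcomp; case fz: (f z) => [w|] //= gw.
    by rewrite /upset/= (gP _ _ gw) -upsetE -rf; exists z.
  move=> vp; have [w gw] : pran g p.
    rewrite rg; apply: leNn_trans vp.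
    by rewrite -upsetE -rg; exists j.
  have [z fz] : pran f w by rewrite rf upsetE -(gP _ _ gw).
  by exists z; rewrite /pcomp fz.
- move=> z z' p p'; rewrite /pcomp.
  case fz: (f z) => [w|] //= gw; case fz': (f z') => [w'|] //= gw'.
  by rewrite (ef _ _ _ _ fz fz') (eg _ _ _ _ gw gw').
Qed.

Record ipf := IPF {
  pfun :> Nn n -> option (Nn n);
  pfun_iso : principal_filter_iso pfun
}.

Lemma ipf_ext (a b : ipf) : (forall z, a z = b z) -> a = b.
Proof.
case: a b => [f hf] [g hg] /= /funext fg; case: _ / fg in hg *.
by congr IPF; exact: Prop_irrelevance.
Qed.

Definition ipf_mul (a b : ipf) := IPF (pcomp_iso (pfun_iso a) (pfun_iso b)).

Lemma ipf_mulA : associative ipf_mul.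
Proof. by move=> a b c; apply: ipf_ext => z /=; rewrite /pcomp; case: (a z). Qed.

HB.instance Definition _ := gen_eqMixin ipf.
HB.instance Definition _ := gen_choiceMixin ipf.
HB.instance Definition _ := isSemigroup.Build ipf ipf_mulA.

Definition oneNn : Nn n := [ffun=> exist _ 1%N isT].

Lemma ipf_inj (a : ipf) z z' w : a z = Some w -> a z' = Some w -> z = z'.
Proof.
case: (pfun_iso a) => [x [y [_ _ e]]] az az'.
by apply: leNn_anti; rewrite (e _ _ _ _ az az', e _ _ _ _ az' az) leNn_refl.
Qed.

Lemma upset_inj x y : upset x = upset y -> x = y.
Proof.
move=> xy; apply: leNn_anti; rewrite -upsetE.
  by rewrite xy; exact: leNn_refl.
by rewrite -xy; exact: leNn_refl.
Qed.

Lemma Some_iso : principal_filter_iso Some.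
Proof.
have h1 z : leNn oneNn z by apply/forallP => i; rewrite ffunE; exact: valP.
exists oneNn, oneNn; split; last by move=> z z' w w' [->] [->].
- by apply/seteqP; split=> z _; [exact: h1 | exists z].
- by apply/seteqP; split=> z _; [exact: h1 | exists z].
Qed.

Lemma ipf_inverse_semigroup : inverse_semigroup ipf.
Proof.
split=> [a|a b].
  pose g w := xget None [set o | exists2 z, a z = Some w & o = Some z].
  have gP w z : (g w = Some z) <-> (a z = Some w).
    split=> [|az]; rewrite /g.
      by case: xgetP => // _ -> [z' az' ->] [<-].
    by apply: xget_unique => [|_ [z' az' ->]]; [exists z | rewrite (ipf_inj az' az)].
  have gi : principal_filter_iso g.
    case: (pfun_iso a) => [x [y [dx ry e]]]; exists y, x; split.
    - by rewrite -ry; apply/seteqP; split=> w [z /gP]; exists z.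
    - by rewrite -dx; apply/seteqP; split=> w [z /gP]; exists z.
    - by move=> z z' w w' /gP h /gP h'; rewrite (e _ _ _ _ h h').
  exists (IPF gi); apply: ipf_ext => z /=; rewrite /pcomp /=.
  by case az: (a z) => [w|] //=; rewrite (gP w z).2.
have idP (c : ipf) : idempotent c -> forall z w, c z = Some w -> w = z.
  move=> cc z w cz; have := congr1 (fun d : ipf => d z) cc.
  by rewrite /= /pcomp cz /= => cw; exact: ipf_inj cw cz.
move=> /idP ha /idP hb; apply: ipf_ext => z /=; rewrite /pcomp.
case az: (a z) => [w|]; case bz: (b z) => [w'|] //=.
- by rewrite (ha _ _ az) (hb _ _ bz) az bz (ha _ _ az) (hb _ _ bz).
- by rewrite (ha _ _ az) bz.
- by rewrite (hb _ _ bz) az.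
Qed.

Lemma ipf_Cmg_least : least_group_congruence (@Cmg ipf).
Proof. exact: Cmg_least (inhabits (IPF Some_iso)) ipf_inverse_semigroup. Qed.

Local Open Scope ring_scope.

Definition toZ x : 'rV[int]_n := \row_i (val (x i))%:Z.

(* The action (z)s = (z_{(1)s^-1}, ..., z_{(n)s^-1}). *)
Definition perm_tuple (z : 'rV[int]_n) (s : 'S_n) : 'rV[int]_n :=
  \row_i z 0 (s^-1%g i).

(* In the three definitions below the default value of xget is never reached:
   every element of [ipf] has exactly one x, y and sigma. *)
Definition ipf_x (a : ipf) : Nn n := xget oneNn [set x | pdom a = upset x].

Definition ipf_y (a : ipf) : Nn n := xget oneNn [set y | pran a = upset y].

Definition ipf_sigma (a : ipf) : 'S_n :=
  xget 1%g [set s | forall z w, a z = Some w ->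
    toZ w = perm_tuple (toZ z - toZ (ipf_x a) + const_mx 1) s
            + toZ (ipf_y a) - const_mx 1].

Lemma pdomE (a : ipf) : pdom a = upset (ipf_x a).
Proof.
by apply: (@xgetPex _ _ [set x | pdom a = upset x]);
  case: (pfun_iso a) => [x [y []]]; exists x.
Qed.

Lemma pranE (a : ipf) : pran a = upset (ipf_y a).
Proof.
by apply: (@xgetPex _ _ [set y | pran a = upset y]);
  case: (pfun_iso a) => [x [y []]]; exists y.
Qed.

End PartialMaps.

(* Main.v *)
(** An order automorphism of [nat^I] permutes the atoms [e_i]; comparing the
multiples [k e_i] shows that it permutes the coordinates.  Translating the two
filters to the origin, every [alpha] is therefore the restriction of the affine
bijection [z |-> (z)sigma - c] of [Z^n], where [c = (x)sigma - y].  Two such maps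
have a common restriction to a principal filter iff their linear parts [sigma]
and their translations [c] agree, and restricting to a principal filter of the
range is right multiplication by an idempotent. *)

Require Import Defs.
From mathcomp Require Import all_boot all_fingroup all_algebra.
From mathcomp Require Import boolp classical_sets.
From mathcomp Require Import zify ring.

Set Implicit Arguments.
Unset Strict Implicit.
Unset Printing Implicit Defensive.

Import GRing.Theory.

(** * Order automorphisms of [nat^I] *)

Section OrderAutomorphisms.
Variable I : finType.
Implicit Types (u v : {ffun I -> nat}) (F G : {ffun I -> nat} -> {ffun I -> nat}).

Definition leF u v := [forall i, u i <= v i].

Definition axis (i : I) (k : nat) : {ffun I -> nat} :=
  [ffun j => if j == i then k else 0].

Lemma leFP u v : reflect (forall i, u i <= v i) (leF u v).
Proof. exact: forallP. Qed.

Lemma leF_anti u v : leF u v -> leF v u -> u = v.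
Proof.
by move=> /leFP uv /leFP vu; apply/ffunP => i; apply/eqP; rewrite eqn_leq uv vu.
Qed.

Lemma leF_axis i k u : leF (axis i k) u = (k <= u i).
Proof.
apply/leFP/idP => [/(_ i)|h j]; rewrite ffunE ?eqxx //.
by case: eqP => // ->.
Qed.

(** The inverse [G] is an explicit argument, so each result on [F] also applies to [G]. *)
Definition order_auto F G :=
  [/\ cancel F G, cancel G F & forall u v, leF (F u) (F v) = leF u v].

Lemma order_auto_sym F G : order_auto F G -> order_auto G F.
Proof. by move=> [FG GF mF]; split=> // u v; rewrite -mF !GF. Qed.

Lemma order_auto0 F G : order_auto F G -> F [ffun => 0] = [ffun => 0].
Proof.
have le0 u : leF [ffun => 0] u by apply/leFP => i; rewrite ffunE.
by move=> [FG GF mF]; apply: leF_anti => //; rewrite -{2}[[ffun => 0]]GF mF.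
Qed.

Lemma axis1_or0 u i : leF u (axis i 1) -> u = [ffun => 0] \/ u = axis i 1.
Proof.
move=> /leFP h; case ui: (u i) => [|m]; [left|right]; apply/ffunP => j;
  move: (h j); rewrite !ffunE; case: eqP => [->|_]; rewrite ?ui; lia.
Qed.

Lemma axis1_neq0 i : axis i 1 <> [ffun => 0].
Proof. by move/ffunP => /(_ i); rewrite !ffunE eqxx. Qed.

Lemma axis1_inj : injective (axis^~ 1).
Proof. by move=> i j /ffunP /(_ i); rewrite !ffunE eqxx; case: eqP. Qed.

(** [F (axis i 1)] is nonzero, hence lies above some [axis j 1]; then [G (axis j 1)] is nonzero and
    below the atom [axis i 1], so it equals it. *)
Lemma order_auto_axis1 F G i : order_auto F G -> exists j, F (axis i 1) = axis j 1.
Proof.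
move=> FGa; have [FG GF mF] := FGa; have F0 := order_auto0 FGa.
case: (pickP (fun j => 0 < F (axis i 1) j)) => [j hj|h]; last first.
  case: (@axis1_neq0 i); rewrite -[axis i 1]FG -[RHS]FG F0; congr G.
  by apply/ffunP => j; rewrite ffunE; have := h j; case: (F _ j).
exists j; rewrite -[axis j 1]GF; congr F; symmetry.
have : leF (G (axis j 1)) (axis i 1) by rewrite -mF GF leF_axis.
move=> /axis1_or0 [] // h0; case: (@axis1_neq0 j).
by rewrite -[axis j 1]GF h0.
Qed.

Lemma order_auto_axis1_perm F G : order_auto F G ->
  exists s : {perm I}, forall i, F (axis i 1) = axis (s i) 1.
Proof.
move=> FGa; have [FG GF mF] := FGa.
have [s sP] := choice (fun i => order_auto_axis1 i FGa).
have sI : injective s.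
  by move=> i j ij; apply/axis1_inj/(can_inj FG); rewrite !sP ij.
by exists (perm sI) => i; rewrite permE.
Qed.

Lemma order_auto_le F G (s : {perm I}) : order_auto F G ->
  (forall i, F (axis i 1) = axis (s i) 1) -> forall u i, u i <= F u (s i).
Proof.
move=> [FG GF mF] sP u i.
(* A positive coordinate [j] puts the atom at [j], which is the image of the atom at [s^-1 j], below
   [F (axis i k)]; pulling back along [F] leaves only [j = s i]. *)
have supp k j : 0 < F (axis i k) j -> j = s i.
  rewrite -leF_axis -{1}(permKV s j) -sP mF leF_axis ffunE.
  by case: eqP => // <-; rewrite permKV.
suff le_axis k : k <= F (axis i k) (s i).
  apply: leq_trans (le_axis (u i)) _; move: (s i); apply/leFP.
  by rewrite mF leF_axis.
(* The images of the multiples of an atom live on the single coordinate [s i], so their values there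
   must increase strictly with [k]. *)
elim: k => // k /leq_ltn_trans; apply; rewrite ltnNge; apply/negP => h.
have : leF (F (axis i k.+1)) (F (axis i k)).
  apply/leFP => j; case: (posnP (F (axis i k.+1) j)) => [-> //|/supp -> //].
by rewrite mF leF_axis ffunE eqxx ltnn.
Qed.

(** The lower bound for [F] and the one for [G], whose permutation of atoms is [s^-1], squeeze to an
    equality. *)
Lemma order_auto_perm F G : order_auto F G ->
  exists s : {perm I}, forall u i, F u (s i) = u i.
Proof.
move=> FGa; have [s sP] := order_auto_axis1_perm FGa; exists s => u i.
have [FG GF _] := FGa.
have GP j : G (axis j 1) = axis (s^-1%g j) 1.
  by rewrite -(FG (axis (s^-1%g j) 1)) sP permKV.
apply/eqP; rewrite eqn_leq (order_auto_le FGa sP) andbT.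
by have := order_auto_le (order_auto_sym FGa) GP (F u) (s i); rewrite FG permK.
Qed.

End OrderAutomorphisms.

(** * Isomorphisms of principal filters as restrictions of affine maps *)

Section Ipf.
Variable n : nat.
Implicit Types (x y z w : Nn n) (u v : {ffun 'I_n -> nat}) (a b e : ipf n).

Lemma translate_gt0 x u i : 0 < val (x i) + u i.
Proof. by rewrite addn_gt0 (valP (x i)). Qed.

(** Order isomorphism from [nat^n] onto the filter generated by [x], sending 0 to [x]. *)
Definition translate x u : Nn n :=
  [ffun i => exist _ (val (x i) + u i) (translate_gt0 x u i)].

Lemma leNn_translate x u v : leNn (translate x u) (translate x v) = leF u v.
Proof. by apply: eq_forallb => i; rewrite !ffunE /= leq_add2l. Qed.

Lemma translate_inj x : injective (translate x).
Proof.
by move=> u v uv; apply: leF_anti; rewrite -(leNn_translate x) uv leNn_refl.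
Qed.

Lemma toZ_translate x u i :
  (toZ (translate x u) 0 i = (val (x i))%:Z + (u i)%:Z)%R.
Proof. by rewrite mxE ffunE. Qed.

Lemma leNn_translater x u : leNn x (translate x u).
Proof. by apply/forallP => i; rewrite ffunE leq_addr. Qed.

Lemma leNnE x z : leNn x z -> exists u, z = translate x u.
Proof.
move=> /forallP h; exists [ffun i => val (z i) - val (x i)].
by apply/ffunP => i; apply: val_inj; rewrite ffunE /= ffunE (subnKC (h i)).
Qed.

Local Open Scope ring_scope.

Lemma toZ_inj : injective (@toZ n).
Proof.
move=> z w /rowP h; apply/ffunP => i; apply: val_inj.
by have := h i; rewrite !mxE => -[].
Qed.

Lemma perm_tuple_inj s : injective (@perm_tuple n ^~ s).
Proof.
by move=> p q /rowP h; apply/rowP => i; have := h (s i); rewrite !mxE permK.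
Qed.

Lemma ipf_defined a z : leNn (ipf_x a) z -> exists w, a z = Some w.
Proof. by move=> h; change (pdom a z); rewrite pdomE. Qed.

Lemma ipf_attained a w : leNn (ipf_y a) w -> exists z, a z = Some w.
Proof. by move=> h; change (pran a w); rewrite pranE. Qed.

Lemma ipf_dom a z w : a z = Some w -> leNn (ipf_x a) z.
Proof. by move=> h; rewrite -upsetE -pdomE; exists w. Qed.

Lemma ipf_ran a z w : a z = Some w -> leNn (ipf_y a) w.
Proof. by move=> h; rewrite -upsetE -pranE; exists z. Qed.

Lemma ipf_embedding a : order_embedding a.
Proof. by case: (pfun_iso a) => x [y []]. Qed.

(** Conjugating [a] by the translations to [ipf_x a] and [ipf_y a] gives an order automorphism of
    [nat^n], which is a permutation of coordinates. *)
Lemma ipf_sigma_exists a : exists s : 'S_n, forall z w, a z = Some w ->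
  toZ w = perm_tuple (toZ z - toZ (ipf_x a) + const_mx 1) s
          + toZ (ipf_y a) - const_mx 1.
Proof.
set x := ipf_x a; set y := ipf_y a.
have exF u : exists v, a (translate x u) = Some (translate y v).
  have [w aw] := ipf_defined (leNn_translater x u).
  by have [v wv] := leNnE (ipf_ran aw); exists v; rewrite aw wv.
have exG v : exists u, a (translate x u) = Some (translate y v).
  have [z az] := ipf_attained (leNn_translater y v).
  by have [u zu] := leNnE (ipf_dom az); exists u; rewrite -zu az.
have [[F FP] [G GP]] := (choice exF, choice exG).
have FGa : order_auto F G.
  split=> [u|v|u v].
  - exact/(@translate_inj x)/(ipf_inj (GP _) (FP _)).
  - by apply: (@translate_inj y); have := FP (G v); rewrite GP => -[].
  - rewrite -(leNn_translate y) -(leNn_translate x); symmetry.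
    exact: ipf_embedding (FP u) (FP v).
have [s sP] := order_auto_perm FGa; exists s => z w az.
have [u zu] := leNnE (ipf_dom az).
have -> : w = translate y (F u) by move: az; rewrite zu FP => -[].
(* Coordinate [i] of [F u] is [u] at [s^-1 i], and the two constant vectors 1 cancel. *)
apply/rowP => i; rewrite !mxE zu !ffunE /= -{2}(permKV s i) sP !PoszD.
ring.
Qed.

Definition ipf_shift a : 'rV[int]_n :=
  perm_tuple (toZ (ipf_x a)) (ipf_sigma a) - toZ (ipf_y a).

Lemma ipf_affine a z w : a z = Some w ->
  toZ w = perm_tuple (toZ z) (ipf_sigma a) - ipf_shift a.
Proof.
move=> az.
have -> : toZ w = perm_tuple (toZ z - toZ (ipf_x a) + const_mx 1) (ipf_sigma a)
                  + toZ (ipf_y a) - const_mx 1.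
  exact: (@xgetPex _ _ [set s | _] (ipf_sigma_exists a) z w az).
by apply/rowP => i; rewrite !mxE; ring.
Qed.

(** * The congruence as existence of a common restriction *)

Definition filter_id y : Nn n -> option (Nn n) :=
  fun z => if leNn y z then Some z else None.

Lemma filter_id_iso y : principal_filter_iso (filter_id y).
Proof.
rewrite /filter_id; exists y, y; split=> [||z z' w w'].
- by apply/seteqP; split=> z; rewrite /pdom /upset /=; case: ifP => // _;
    [case | exists z].
- apply/seteqP; split=> w; rewrite /pran /upset /=.
    by case=> z; case: ifP => // yz [<-].
  by move=> yw; exists w; rewrite yw.
- by case: ifP => // _ [<-]; case: ifP => // _ [<-].
Qed.

Lemma ipf_idempotent_fix e z w : Defs.idempotent e -> e z = Some w -> w = z.
Proof.
move=> ee ez; have := congr1 (fun d : ipf n => d z) ee.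
by rewrite /= /pcomp ez /= => ew; exact: ipf_inj ew ez.
Qed.

(** An idempotent is the identity of a filter, and multiplying by it on the right cuts the range
    down to that filter; hence the condition bears on the values [w]. *)
Lemma Cmg_common_restriction a b : Cmg a b <->
  exists y, forall z w, leNn y w -> (a z = Some w <-> b z = Some w).
Proof.
split=> [[e [ee ab]]|[v abv]].
  have transfer (c d : ipf n) z w : (c * e = d * e)%g -> leNn (ipf_x e) w ->
      c z = Some w -> d z = Some w.
    move=> cd xw cz; have [w' ew] := ipf_defined xw.
    have := congr1 (fun f : ipf n => f z) cd; rewrite /= /pcomp cz /= ew.
    case: (d z) => [t|] //= et.
    by rewrite -(ipf_idempotent_fix ee (esym et)) (ipf_idempotent_fix ee ew).
  by exists (ipf_x e) => z w xw; split; apply: transfer.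
exists (IPF (filter_id_iso v)); split; apply: ipf_ext => z /=.
  by rewrite /pcomp /= /filter_id; case: ifP => //= ->.
rewrite /pcomp /= /filter_id.
case az: (a z) => [w|] /=; case bz: (b z) => [w'|] //=.
- case: ifP => vw; case: ifP => vw' //.
  + by move: az; rewrite abv // bz => -[->].
  + by move: az; rewrite abv // bz => -[ww']; rewrite -ww' vw' in vw.
  + by move: bz; rewrite -abv // az => -[ww']; rewrite -ww' vw in vw'.
- by case: ifP => // vw; move: az; rewrite abv // bz.
- by case: ifP => // vw; move: bz; rewrite -abv // az.
Qed.

(** Above both [ipf_y a] and [ipf_y b] every value is attained by both maps, and injectivity of the
    shared affine map makes the preimages equal. *)
Lemma Cmg_of_affine a b :
  ipf_sigma a = ipf_sigma b -> ipf_shift a = ipf_shift b -> Cmg a b.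
Proof.
move=> sab cab; apply/Cmg_common_restriction.
exists (joinNn (ipf_y a) (ipf_y b)) => z w; rewrite joinNnP => /andP[yaw ybw].
have [z1 az1] := ipf_attained yaw; have [z2 bz2] := ipf_attained ybw.
have z12 : z1 = z2.
  apply/toZ_inj/(@perm_tuple_inj (ipf_sigma a))/(addIr (- ipf_shift a)).
  by rewrite -(ipf_affine az1) (ipf_affine bz2) sab cab.
split=> h; first by rewrite (ipf_inj h az1) z12.
by rewrite (ipf_inj h bz2) -z12.
Qed.

Lemma affine_of_Cmg a b : Cmg a b ->
  ipf_sigma a = ipf_sigma b /\ ipf_shift a = ipf_shift b.
Proof.
move=> /Cmg_common_restriction [v abv].
(* Since [z0] is sent above [v], so is its whole filter, and there [a] and [b] agree. *)
have [z0 az0] : exists z, a z = Some (joinNn (ipf_y a) v).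
  by apply: ipf_attained; have := leNn_refl (joinNn (ipf_y a) v);
    rewrite joinNnP => /andP[].
have agree u : perm_tuple (toZ (translate z0 u)) (ipf_sigma a) - ipf_shift a
             = perm_tuple (toZ (translate z0 u)) (ipf_sigma b) - ipf_shift b.
  have [w aw] := ipf_defined (leNn_trans (ipf_dom az0) (leNn_translater z0 u)).
  have vw : leNn v w.
    have := leNn_translater z0 u; rewrite (ipf_embedding az0 aw) joinNnP.
    by case/andP.
  by rewrite -(ipf_affine aw) -(ipf_affine ((abv _ _ vw).1 aw)).
(* Passing from [z0] to [z0] plus the atom at [i] raises coordinate [ipf_sigma a i] by 1 under [a],
   but by 0 under [b] if the permutations differ at [i]. *)
have sab : ipf_sigma a = ipf_sigma b.
  apply/permP => i; apply/eqP/contraT => nab.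
  have /rowP /(_ (ipf_sigma a i)) := agree [ffun => 0%N].
  have /rowP /(_ (ipf_sigma a i)) := agree (axis i 1).
  rewrite ![fun_of_matrix (_ - _) _ _]mxE ![perm_tuple _ _ 0 _]mxE.
  rewrite !toZ_translate !ffunE permK eqxx ifN; first lia.
  by apply: contraNneq nab => h; rewrite -{2}h permKV.
split=> //; have := agree [ffun => 0%N]; rewrite sab => /addrI.
exact: oppr_inj.
Qed.

End Ipf.

Local Open Scope ring_scope.

Theorem theorem2p21 (n : nat) (hn : (0 < n)%N) (alpha beta : ipf n) :
  Cmg alpha beta <->
  ipf_sigma alpha = ipf_sigma beta /\
  perm_tuple (toZ (ipf_x alpha)) (ipf_sigma alpha) - toZ (ipf_y alpha) =
  perm_tuple (toZ (ipf_x beta)) (ipf_sigma beta) - toZ (ipf_y beta).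
Proof. by split=> [/affine_of_Cmg|[]]; last exact: Cmg_of_affine. Qed.
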